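(* Let $\Delta$ be a vertex decomposable simplicial complex with (nonempty, finite) vertex set $V$, and let $I_\Delta\subset K[V]$ be its Stanley--Reisner ideal over a field $K$. Then $$\mathrm{v}(I_\Delta)\leq \mathrm{reg}(K[V]/I_\Delta).$$
   Context: A simplicial complex $\Delta$ with vertex set $V$ is a family of subsets of $V$ (faces) closed under taking subsets and with $\{v\}\in\Delta$ for all $v\in V$. Elements of $V$ are identified with the variables of the polynomial ring $S=K[V]=\bigoplus_{d\ge0}S_d$ (standard grading). The Stanley--Reisner ideal $I_\Delta$ is generated by all squarefree monomials $\prod_{v\in F}v$ with $F\subset V$, $F\notin\Delta$. The facets of $\Delta$ are its maximal faces. For a vertex $v$: the deletion $\mathrm{del}_\Delta(v)$ is the subcomplex on $V\setminus\{v\}$ of all faces of $\Delta$ not containing $v$; the link is $\mathrm{lk}_\Delta(v)=\{H\in\Delta \mid v\notin H,\ H\cup\{v\}\in\Delta\}$. The complex $\Delta$ is vertex decomposable (recursive definition) if either $\Delta$ is a simplex (the family of all subsets of a finite set), or $\Delta=\emptyset$, or $\Delta$ contains a vertex $v$ (a shedding vertex) such that both $\mathrm{lk}_\Delta(v)$ and $\mathrm{del}_\Delta(v)$ are vertex decomposable and every facet of $\mathrm{del}_\Delta(v)$ is a facet of $\Delta$. (Links and deletions are regarded as complexes on their own vertices.) For a proper squarefree monomial ideal $I\subset S$, the v-number is $\mathrm{v}(I)=\min\{d\geq 0 \mid \exists f\in S_d\text{ and }\mathfrak{p}\in\mathrm{Ass}(I)\text{ with }(I\colon f)=\mathfrak{p}\}$,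 where $\mathrm{Ass}(I)$ is the set of associated primes of $S/I$; in particular $\mathrm{v}(I)=0$ if $I$ is prime. The regularity of $S/I$ is $\mathrm{reg}(S/I)=\max\{j-i \mid b_{i,j}\neq 0\}$, where $b_{i,j}$ are the graded Betti numbers of the minimal graded free resolution of $S/I$ over $S$. *)

(* Defs.v *)
From mathcomp Require Import all_boot all_order all_algebra.
From mathcomp Require Import mpoly.
From mathcomp Require Import boolp.

Set Implicit Arguments.
Unset Strict Implicit.
Unset Printing Implicit Defensive.

Import GRing.Theory.
Local Open Scope ring_scope.

Section SimplicialComplexes.
Variable V : finType.
Implicit Types (D : {set {set V}}) (F G : {set V}) (v : V).

(* A family of faces on the full vertex set V. *)
Definition simplicial_complex D : Prop :=
  (forall F G, G \subset F -> F \in D -> G \in D)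
  /\ (forall v, [set v] \in D).

Definition facets D : {set {set V}} :=
  [set F | maxset (fun G => G \in D) F].

(* The deletion and the link live on fewer vertices than D. They stay families
   of subsets of V, and the vertices of such a family D are the v with
   [set v] \in D. *)
Definition del D v : {set {set V}} := [set F in D | v \notin F].

Definition link D v : {set {set V}} :=
  [set F in D | (v \notin F) && (v |: F \in D)].

Inductive vertex_decomposable : {set {set V}} -> Prop :=
| vd_simplex (A : {set V}) : vertex_decomposable (powerset A)
| vd_void : vertex_decomposable set0
| vd_shedding D v :
    [set v] \in D ->
    vertex_decomposable (link D v) ->
    vertex_decomposable (del D v) ->
    facets (del D v) \subset facets D ->
    vertex_decomposable D.

End SimplicialComplexes.

Section StanleyReisner.
Variables (K : fieldType) (V : finType).

(* K[V]: the vertex v is the variable of index enum_rank v. *)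
Definition face_monomial (F : {set V}) : {mpoly K[#|V|]} :=
  \prod_(v in F) 'X_(enum_rank v).

Definition stanley_reisner (D : {set {set V}}) : {pred {mpoly K[#|V|]}} :=
  fun f => `[< exists c : {set V} -> {mpoly K[#|V|]},
    f = \sum_(F : {set V} | F \notin D) c F * face_monomial F >].

End StanleyReisner.

Arguments face_monomial K {V} F.
Arguments stanley_reisner K {V} D.

Section Invariants.
Variables (K : fieldType) (n : nat).
Notation S := {mpoly K[n]}.
Implicit Types (I P : {pred S}) (f : S).

Definition colon I f : {pred S} := fun g => g * f \in I.

(* idealr_closed includes properness. *)
Definition prime_ideal P : Prop := idealr_closed P /\ prime_idealr_closed P.

(* The annihilator in S/I of the class of f is colon I f. *)
Definition associated_prime I P : Prop :=
  prime_ideal P /\ exists f, colon I f =i P.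

Definition v_witness I (d : nat) : Prop :=
  exists f P, [/\ f \is d.-homog, associated_prime I P & colon I f =i P].

Definition is_v_number I (d : nat) : Prop :=
  v_witness I d /\ forall e, v_witness I e -> (d <= e)%N.

(* A sequence of maps ... -> F_2 -> F_1 -> F_0 -> S together with the degrees
   of the basis elements: F_i is the direct sum of the S(- gf_deg i k), for
   k < gf_rank i, written as row vectors, on which the matrices act on the
   right. The last map, gf_aug, is a lift of the augmentation F_0 -> S/I. All
   degrees can be taken in nat because S/I has no elements of negative
   degree. *)
Record graded_free_sequence := GradedFreeSequence {
  gf_rank : nat -> nat;
  gf_deg : forall i, 'I_(gf_rank i) -> nat;
  gf_diff : forall i, 'M[S]_(gf_rank i.+1, gf_rank i);
  gf_aug : 'cV[S]_(gf_rank 0)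
}.
Implicit Type (X : graded_free_sequence).

(* The maps preserve degrees: a nonzero entry in row k and column l is
   homogeneous of degree deg k - deg l. *)
Definition gf_graded X : Prop :=
  (forall i (k : 'I_(gf_rank X i.+1)) (l : 'I_(gf_rank X i)),
     {in msupp (gf_diff X i k l), forall m,
        (mdeg m + gf_deg l = gf_deg k)%N})
  /\ (forall k : 'I_(gf_rank X 0), gf_aug X k ord0 \is (gf_deg k).-homog).

(* Exactness of ... -> F_1 -> F_0 -> S/I -> 0. *)
Definition gf_resolves I X : Prop :=
  [/\ forall f, exists u : 'rV[S]_(gf_rank X 0),
        f - (u *m gf_aug X) ord0 ord0 \in I,
      forall u : 'rV[S]_(gf_rank X 0),
        (u *m gf_aug X) ord0 ord0 \in I <->
        exists w : 'rV[S]_(gf_rank X 1), u = w *m gf_diff X 0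
    & forall i (u : 'rV[S]_(gf_rank X i.+1)),
        u *m gf_diff X i = 0 <->
        exists w : 'rV[S]_(gf_rank X i.+2), u = w *m gf_diff X i.+1].

(* The image of F_{i+1} lies in (x_1, ..., x_n) F_i. *)
Definition gf_minimal X : Prop :=
  forall i (k : 'I_(gf_rank X i.+1)) (l : 'I_(gf_rank X i)),
    (gf_diff X i k l)@_0%MM = 0.

Definition minimal_graded_free_resolution I X : Prop :=
  [/\ gf_graded X, gf_resolves I X & gf_minimal X].

Definition betti X (i j : nat) : nat :=
  #|[pred k : 'I_(gf_rank X i) | gf_deg k == j]|.

(* r = reg (S/I). *)
Definition is_regularity I (r : int) : Prop :=
  exists X, [/\ minimal_graded_free_resolution I X,
    exists i j : nat, betti X i j != 0%N /\ r = j%:Z - i%:Z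
  & forall i j : nat, betti X i j != 0%N -> j%:Z - i%:Z <= r].

End Invariants.

(* Main.v *)
Require Import Defs.
From mathcomp Require Import all_boot all_order all_algebra.
From mathcomp Require Import mpoly.
From mathcomp Require Import boolp zify ring.

(* A vertex decomposable complex has a facet [F] and a face [A] contained in no
   other facet such that the link of [F :\: A] carries a simplicial cycle with
   a nonzero coefficient at [A]; both are built by recursion along shedding
   vertices, the cycle being a suspension. Uniqueness of [F] makes
   [(I : x^A)] the prime generated by the variables outside [F], hence
   [v(I) <= #|A|]. It also makes [x^A e_(~: F)] a Koszul cycle of [S / I], and
   pairing with the simplicial cycle shows that it is not a boundary. By balance
   of Tor, every graded free resolution of [S / I] then has, for some [i], a
   generator of degree at least [#|A| + i] in homological degree [i]. *)

Set Implicit Arguments.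
Unset Strict Implicit.
Unset Printing Implicit Defensive.
Import GRing.Theory Num.Theory.
Local Open Scope ring_scope.

(** * Signed chains on subsets of [V]: Koszul differential and cone *)

Section KoszulChains.
Variable V : finType.
Implicit Types (s t v : V) (W : {set V}).

Definition rank_lt s t := (enum_rank s < enum_rank t)%N.

(** The exponent of the sign relating [e_t] times [e_W] to the basis element of [t |: W]. *)
Definition parity t W : bool := odd #|[set u in W | rank_lt u t]|.

Lemma parityU s t W : s \notin W -> parity t (s |: W) = rank_lt s t (+) parity t W.
Proof.
move=> sW; rewrite /parity; case st: (rank_lt s t).
  have -> : [set u in s |: W | rank_lt u t] = s |: [set u in W | rank_lt u t].
    by apply/setP=> u; rewrite !inE; case: eqP => // ->; rewrite st.
  by rewrite cardsU1 inE (negbTE sW).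
rewrite addFb; congr (odd _); apply: eq_card => u; rewrite !inE.
by case: eqP => // ->; rewrite st (negbTE sW).
Qed.

Lemma rank_lt_asym s t : s != t -> rank_lt t s = ~~ rank_lt s t.
Proof.
move=> st; rewrite /rank_lt -leqNgt [RHS]leq_eqVlt; case: eqP => //= e.
by case/eqP: st; apply: enum_rank_inj; apply: val_inj; rewrite /= e.
Qed.

Lemma rank_ltxx t : rank_lt t t = false.
Proof. exact: ltnn. Qed.

Lemma parityD1 t W : parity t (W :\ t) = parity t W.
Proof.
case: (boolP (t \in W)) => tW; last by rewrite (setDidPl _) // disjoint_sym disjoints1.
by rewrite -{2}(setD1K tW) parityU ?setD11 // rank_ltxx.
Qed.

Variables (R : comNzRingType) (M : lmodType R).
Implicit Types (x : V -> R) (z : {set V} -> M).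

(* A chain maps [W] to its coefficient on the basis element [e_W] of the
   exterior algebra on [V]. [bd] is the Koszul differential for the sequence
   [x], so it is the reduced simplicial boundary when [x = 1], and [cone v] is
   left multiplication by [e_v]. *)
Definition bd x z W : M :=
  \sum_(t | t \notin W) ((-1) ^+ parity t W * x t) *: z (t |: W).

Definition cone v z W : M :=
  if v \in W then (-1) ^+ parity v W *: z (W :\ v) else 0.

Lemma bd_ext x z1 z2 : z1 =1 z2 -> bd x z1 =1 bd x z2.
Proof. by move=> e W; apply: eq_bigr => t _; rewrite e. Qed.

Lemma bd0 x W : bd x (fun=> 0) W = 0.
Proof. by apply: big1 => t _; rewrite scaler0. Qed.

Lemma bdD x z1 z2 W : bd x (fun F => z1 F + z2 F) W = bd x z1 W + bd x z2 W.
Proof. by rewrite -big_split; apply: eq_bigr => t _; rewrite scalerDr. Qed.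

Lemma bdB x z1 z2 W : bd x (fun F => z1 F - z2 F) W = bd x z1 W - bd x z2 W.
Proof. by rewrite -sumrB; apply: eq_bigr => t _; rewrite scalerBr. Qed.

(** The Leibniz rule for [e_v]: multiplication by [x v] is null-homotopic, and where [x v = 1] the
    cone fills every cycle. *)
Lemma bd_cone x v z W : bd x (cone v z) W = x v *: z W - cone v (bd x z) W.
Proof.
rewrite {1}/bd /cone; case: ifPn => vW; last first.
  rewrite subr0 (bigD1 v) //= setU11 setU1K // parityU // rank_ltxx /=.
  rewrite scalerA mulrAC -signr_addb addbb mul1r big1 ?addr0 // => t /andP[_ tv].
  by rewrite !inE eq_sym (negbTE tv) (negbTE vW) scaler0.
have [B vB {W vW}->] : exists2 B : {set V}, v \notin B & W = v |: B.
  by exists (W :\ v); rewrite ?setD11 ?setD1K.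
rewrite setU1K // /bd (bigD1 v vB) /= [in X in _ - X]parityU // rank_ltxx /=.
rewrite scalerDr scalerA mulrA -signr_addb addbb mul1r opprD addNKr.
rewrite scaler_sumr -sumrN.
apply: eq_big => [t|t]; rewrite !in_setU1 negb_or 1?andbC // => /andP[tB tv].
have tvB : t \notin v |: B by rewrite !inE negb_or tv.
rewrite eqxx orbT setUCA setU1K ?in_setU1 ?negb_or 1?eq_sym ?tv //.
rewrite !parityU // ?in_setU1 ?negb_or 1?[v == t]eq_sym ?tv // rank_ltxx.
rewrite !scalerA -scaleNr (rank_lt_asym tv); congr (_ *: _).
by case: rank_lt; case: (parity t B); case: (parity v B); 
  rewrite /= ?expr0 ?expr1 ?mulN1r ?mulrN ?mulNr ?mul1r ?mulr1 ?opprK.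
Qed.

(** The diagonal gets its own hypothesis because antisymmetry does not make it vanish in
    characteristic 2. *)
Lemma sum_alternating (a : V -> V -> M) :
  (forall t, a t t = 0) -> (forall s t, a s t = - a t s) ->
  \sum_s \sum_t a s t = 0.
Proof.
move=> a0 aN.
rewrite (eq_bigr (fun s => \sum_(t | rank_lt s t) a s t +
                           \sum_(t | rank_lt t s) a s t)).
  rewrite big_split /= [X in _ + X](exchange_big_dep xpredT) //= -big_split /=.
  apply: big1 => s _; rewrite -big_split /=; apply: big1 => t _.
  by rewrite [a t s]aN subrr.
move=> s _; rewrite (bigID (rank_lt s)) /=; congr (_ + _).
rewrite (bigD1 s) ?rank_ltxx //= a0 add0r; apply: eq_bigl => t.
case: (eqVneq t s) => [->|ts]; rewrite ?andbF ?rank_ltxx //.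
by rewrite andbT (rank_lt_asym ts) negbK.
Qed.

Lemma bd_bd x z W : bd x (bd x z) W = 0.
Proof.
pose a s t := if (s \notin W) && (t \notin W) && (s != t) then
  ((-1) ^+ (rank_lt s t (+) parity s W (+) parity t W) * (x s * x t))
    *: z (t |: (s |: W)) else 0.
rewrite -[RHS](@sum_alternating a) /a.
- rewrite /bd big_mkcond; apply: eq_bigr => s _; case: ifP => sW /=; last by rewrite big1.
  rewrite scaler_sumr big_mkcond; apply: eq_bigr => t _.
  rewrite !inE negb_or andbC [t == s]eq_sym; case: ifP => // /andP[tW st].
  rewrite scalerA parityU //; congr (_ *: _).
  rewrite mulrACA -signr_addb; congr ((-1) ^+ _ * _).
  by case: rank_lt; case: parity; case: parity.
- by move=> t; rewrite eqxx andbF.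
move=> s t; rewrite [t == s]eq_sym [(t \notin W) && (s \notin W)]andbC.
case: ifP => [/andP[_ st]|_]; last by rewrite oppr0.
rewrite -scaleNr setUCA [x t * x s]mulrC (rank_lt_asym st); congr (_ *: _).
rewrite -mulNr; congr (_ * _).
by case: rank_lt; case: (parity s W); case: (parity t W); rewrite //= ?opprK.
Qed.

End KoszulChains.

(** * Links, deletions and cycles of vertex decomposable complexes *)

Section VertexDecomposable.
Variable V : finType.
Implicit Types (D : {set {set V}}) (A B F G W : {set V}) (s t v : V).

Definition subset_closed D := forall F G, G \subset F -> F \in D -> G \in D.

Definition face_link D G : {set {set V}} :=
  [set F : {set V} | [disjoint F & G] && (F :|: G \in D)].

Lemma disjoint_setU1 t A B :
  [disjoint t |: A & B] = (t \notin B) && [disjoint A & B].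
Proof. by rewrite -disjointU1; apply: eq_disjoint => s; rewrite !inE. Qed.

Lemma facetsP D F :
  reflect (F \in D /\ forall B, B \in D -> F \subset B -> B = F) (F \in facets D).
Proof. by rewrite inE; apply: maxsetP. Qed.

Lemma subset_closed_link D v : subset_closed D -> subset_closed (link D v).
Proof.
move=> cD F G sGF; rewrite !inE => /and3P[FD vF vFD].
rewrite (cD _ _ sGF FD) (contraNN (subsetP sGF v) vF) /=.
exact: cD (setUS _ sGF) vFD.
Qed.

Lemma subset_closed_del D v : subset_closed D -> subset_closed (del D v).
Proof.
move=> cD F G sGF; rewrite !inE => /andP[FD vF].
by rewrite (cD _ _ sGF FD) (contraNN (subsetP sGF v) vF).
Qed.

Lemma subset_closed_face_link D G : subset_closed D -> subset_closed (face_link D G).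
Proof.
move=> cD F B sBF; rewrite !inE => /andP[dFG FGD].
by rewrite (disjointWl sBF dFG); apply: cD (setSU _ sBF) FGD.
Qed.

Lemma link_face_link D v G : v \notin G ->
  link (face_link D G) v = face_link (link D v) G.
Proof.
move=> vG; apply/setP=> F; rewrite !inE -!setUA disjoint_setU1 negb_or vG.
by case: (v \in F); case: [disjoint F & G]; rewrite ?andbF //= ?andbT.
Qed.

Lemma del_face_link D v G : v \notin G ->
  del (face_link D G) v = face_link (del D v) G.
Proof.
move=> vG; apply/setP=> F; rewrite !inE negb_or vG andbT.
by case: (v \in F); case: [disjoint F & G]; rewrite ?andbF //= ?andbT.
Qed.

Lemma facets_face_link D G F :
  (F \in facets (face_link D G)) = [disjoint F & G] && (F :|: G \in facets D).
Proof.
apply/facetsP/andP => [[]|[dFG /facetsP[FD mF]]].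
  rewrite inE => /andP[dFG FD] mF; split=> //; apply/facetsP; split=> // B BD sB.
  have sGB : G \subset B by apply: subset_trans sB; apply: subsetUr.
  rewrite -(mF (B :\: G)).
  - by rewrite setUC -{1}(setIidPr sGB) setID.
  - rewrite inE -setI_eq0 setIDAC setDIl setDv setI0 eqxx /=.
    by rewrite setUC -{1}(setIidPr sGB) setID.
  rewrite subsetD dFG andbT; apply: subset_trans sB; apply: subsetUl.
split=> [|B]; first by rewrite inE dFG.
rewrite inE => /andP[dBG BD] sFB; have := mF _ BD (setSU _ sFB).
move=> /(congr1 (fun X => X :\: G)); rewrite !setDUl setDv !setU0.
by rewrite !(setDidPl _) // .
Qed.

(** A shedding vertex [v] either lies in [G], where the link of [v] takes over; or stays shedding in
    the link of [G]; or is no vertex of that link, and deleting it changes nothing. *)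
Lemma vertex_decomposable_face_link D G : subset_closed D ->
  vertex_decomposable D -> vertex_decomposable (face_link D G).
Proof.
move=> + dD; elim: dD G => {D} [A|| D v vD _ IHl _ IHd sh] G cD.
- case: (boolP (G \subset A)) => sGA.
    have -> : face_link (powerset A) G = powerset (A :\: G).
      by apply/setP=> F; rewrite !inE subUset sGA andbT subsetD andbC.
    exact: vd_simplex.
  have -> : face_link (powerset A) G = set0.
    by apply/setP=> F; rewrite !inE subUset (negbTE sGA) !andbF.
  exact: vd_void.
- have -> : face_link set0 G = set0 by apply/setP=> F; rewrite !inE andbF.
  exact: vd_void.
case: (boolP (v \in G)) => vG.
  have -> : face_link D G = face_link (link D v) (G :\ v).
    apply/setP=> F; rewrite !inE eqxx /= orbF setUCA setD1K //.
    rewrite -{1}(setD1K vG) disjoint_sym disjoint_setU1 disjoint_sym.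
    case: (boolP (_ \in D)) => FGD; rewrite ?andbF // !andbT.
    suff -> : F :|: G :\ v \in D by case: (v \in F); rewrite ?andbF ?andbT.
    by apply: cD FGD; rewrite setUS // subsetDl.
  exact/IHl/subset_closed_link.
have lE := link_face_link D vG; have dE := del_face_link D vG.
case: (boolP ([set v] \in face_link D G)) => vDG.
  apply: (vd_shedding vDG); rewrite ?lE ?dE.
  - exact/IHl/subset_closed_link.
  - exact/IHd/subset_closed_del.
  apply/subsetP=> F; rewrite !facets_face_link.
  by move=> /andP[-> /(subsetP sh)].
suff -> : face_link D G = del (face_link D G) v.
  by rewrite dE; apply/IHd/subset_closed_del.
apply/setP=> F; rewrite [RHS]inE; case: (boolP (F \in _)) => //= FDG.
apply/esym; apply: contraNN vDG => vF.
by apply: subset_closed_face_link FDG => //; rewrite sub1set.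
Qed.

Variable K : fieldType.
Implicit Types (b c : {set V} -> K^o).

Notation bd1 := (bd (fun=> 1)).

Definition supported c D := forall F, F \notin D -> c F = 0.

(** Homology detected on facets: up to homotopy the complex is a wedge of spheres, each coming from
    a facet. *)
Definition facet_free_cycles_bound D := forall c, supported c D ->
  {in facets D, forall F, c F = 0} -> bd1 c =1 (fun=> 0) ->
  exists2 b, supported b D & bd1 b =1 c.

Lemma supported_cone c D v : subset_closed D ->
  supported c (link D v) -> supported (cone v c) D.
Proof.
move=> cD sc F FD; rewrite /cone; case: ifP => // vF.
rewrite sc ?scaler0 //; apply: contraNN FD; rewrite !inE => /and3P[_ _].
by rewrite setD1K.
Qed.

(* A cycle splits as [v * c1 + c0] with [c1] on the link and [c0] on the
   deletion. Filling [c1] by [b1] moves the cycle to [c0 + b1] on the deletion;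
   as [v] is shedding, [b1] meets no facet of the deletion. *)
Lemma shedding_cycles_bound D v : subset_closed D ->
  facets (del D v) \subset facets D ->
  facet_free_cycles_bound (link D v) -> facet_free_cycles_bound (del D v) ->
  facet_free_cycles_bound D.
Proof.
move=> cD sh Ql Qd c sc fc zc.
pose c1 F := if v \in F then 0 else (-1) ^+ parity v F *: c (v |: F).
pose c0 F := if v \in F then 0 else c F.
have cE : c =1 (fun F => cone v c1 F + c0 F).
  move=> F; rewrite /cone /c1 /c0; case: (boolP (v \in F)) => vF; last by rewrite add0r.
  by rewrite setD11 setD1K // addr0 scalerA parityD1 -signr_addb addbb scale1r.
have c1l : supported c1 (link D v).
  move=> F FD; rewrite /c1; case: ifPn => // vF; rewrite sc ?scaler0 //.
  apply: contraNN FD => FD; rewrite !inE vF FD !andbT.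
  by apply: cD FD; apply: subsetUr.
have bdc W : c1 W - cone v (bd1 c1) W + bd1 c0 W = 0.
  by rewrite -(zc W) (bd_ext _ cE) bdD bd_cone scale1r.
have zc1 : bd1 c1 =1 (fun=> 0).
  move=> W; case: (boolP (v \in W)) => vW.
    by apply: big1 => t _; rewrite /c1 inE vW orbT scaler0.
  (* At [v |: W] the boundary of [c] is, up to sign, the boundary of [c1] at [W]. *)
  have := bdc (v |: W); rewrite {1}/c1 setU11 sub0r /cone setU11 setU1K //.
  rewrite [bd1 c0 _]big1 => [|t _]; last by rewrite /c0 !inE eqxx orbT scaler0.
  by rewrite addr0 => /eqP; rewrite oppr_eq0 scaler_eq0 signr_eq0 => /eqP.
have [|b1 sb1 b1E] := Ql c1 c1l _ zc1.
  move=> F /facetsP[]; rewrite inE => /and3P[FD vF vFD] mF.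
  rewrite /c1 (negbTE vF) fc ?scaler0 //; apply/facetsP; split=> // B BD sB.
  have vB : v \in B by apply: (subsetP sB); rewrite setU11.
  rewrite -(mF (B :\ v)) ?setD1K //.
    by rewrite !inE eqxx setD1K //= BD andbT; apply: cD BD; apply: subsetDl.
  by rewrite subsetD1 vF andbT (subset_trans _ sB) ?subsetUr.
have [|F /[dup] Ff /(subsetP sh) FfD|W|b0 sb0 b0E] := Qd (fun F => c0 F + b1 F).
- move=> F FD; rewrite /c0; case: ifPn => vF.
    by rewrite add0r sb1 // !inE vF andbF.
  rewrite sc ?sb1 ?addr0 //.
    by apply: contraNN FD; rewrite !inE => /andP[-> _].
  by apply: contraNN FD; rewrite !inE vF => ->.
(* A facet of the deletion is one of [D]: [c] vanishes on it, and [v] cannot be added, so it is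
   outside the link. *)
- have -> : c0 F = 0 by rewrite /c0 fc //; case: ifP.
  rewrite add0r sb1 //; case/facetsP: FfD => _ mF.
  rewrite !inE; apply/negP => /and3P[_ vF vFD].
  by case/negP: vF; rewrite -(mF _ vFD) ?setU11 ?subsetUr.
- rewrite bdD b1E; have := bdc W; rewrite /cone.
  by case: ifP => _; rewrite ?zc1 ?scaler0 subr0 addrC //.
(* The boundary is [(c0 + b1) - (b1 - cone v c1)], which is [c]. *)
exists (fun F => b0 F - cone v b1 F).
  move=> F FD; rewrite (supported_cone cD sb1) // sb0 ?subr0 //.
  by apply: contraNN FD; rewrite inE => /andP[].
move=> W; rewrite bdB b0E bd_cone scale1r cE opprB addrACA subrr addr0 addrC.
by congr (_ + _); rewrite /cone b1E.
Qed.

Lemma vertex_decomposable_cycles_bound D :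
  subset_closed D -> vertex_decomposable D -> facet_free_cycles_bound D.
Proof.
move=> + dD; elim: dD => {D} [A|| D v vD _ IHl _ IHd sh] cD.
(* If [A] is empty, its only face is a facet and [c] vanishes; otherwise any [t] in [A] is a cone
   point. *)
- move=> c sc fc zc; case: (set_0Vmem A) => [A0|[t tA]].
    have c0 F : c F = 0.
      case: (eqVneq F set0) => [->|F0].
        apply: fc; apply/facetsP; rewrite A0; split=> [|B]; first by rewrite inE.
        by rewrite inE subset0 => /eqP.
      by apply: sc; rewrite A0 inE subset0.
    by exists (fun=> 0) => // W; rewrite bd0 c0.
  exists (cone t c).
    move=> F FA; rewrite /cone; case: ifP => // tF; rewrite sc ?scaler0 //.
    apply: contraNN FA; rewrite !inE => sFA.
    by rewrite -(setD1K tF) subUset sub1set tA.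
  by move=> W; rewrite bd_cone scale1r /cone zc scaler0 if_same subr0.
- move=> c sc _ _; exists (fun=> 0) => // W; rewrite bd0 sc ?inE //.
apply: (shedding_cycles_bound cD sh).
  exact/IHl/subset_closed_link.
exact/IHd/subset_closed_del.
Qed.

(** The star of [A] is the simplex on [F]. *)
Definition unique_facet D A F :=
  [/\ A \subset F, F \in D & forall B, B \in D -> A \subset B -> B \subset F].

(* In terms of a shelling order, [F] is the last facet and [A] its restriction
   set, the unique minimal face that [F] adds to the earlier facets. *)
Lemma unique_facet_cycle D :
  subset_closed D -> vertex_decomposable D -> set0 \in D ->
  exists A F c, [/\ unique_facet D A F, supported c (face_link D (F :\: A)),
                   bd1 c =1 (fun=> 0) & c A != 0].
Proof.
move=> + dD; elim: dD => {D} [B|| D v vD _ IHl dd _ sh] cD D0.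
- exists set0, B, (fun F => (F == set0)%:R); split.
  + by split=> [||G]; rewrite ?sub0set ?inE.
  + move=> F; case: eqP => // ->.
    by rewrite !inE setD0 set0U subxx disjoints_subset sub0set.
  + move=> W; apply: big1 => t _; case: eqP; last by rewrite scaler0.
    by move/setP/(_ t); rewrite !inE eqxx.
  + by rewrite eqxx oner_eq0.
- by rewrite inE in D0.
have [||A [F [c [[sAF FD uF] sc zc cA]]]] := IHl.
- exact: subset_closed_link.
- by rewrite !inE D0 setU0.
have vF : v \notin F by move: FD; rewrite inE => /and3P[].
have vA : v \notin A by apply: contraNN vF; apply: (subsetP sAF).
have GE : (v |: F) :\: (v |: A) = F :\: A.
  apply/setP=> t; rewrite !inE negb_or.
  by case: eqP => // ->; rewrite (negbTE vF) andbF.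
set G := F :\: A in sc GE; have vG : v \notin G by rewrite inE (negbTE vF) andbF.
have sdD B : B \in face_link (del D v) G -> B \in face_link D G.
  by rewrite !inE => /and3P[-> ->].
have cdD := @subset_closed_del D v cD.
(* [b] fills [c] inside the deletion, where [c] meets no facet: as [v] is shedding, [v] cannot be
   added to such a facet. *)
have [||b sb bE] :=
  @vertex_decomposable_cycles_bound _ (@subset_closed_face_link _ G cdD)
    (@vertex_decomposable_face_link _ G cdD dd) c _ _ zc.
- move=> B BD; apply: sc; apply: contraNN BD; rewrite !inE.
  by move=> /and4P[-> -> ->].
- move=> B; rewrite facets_face_link => /andP[dBG /(subsetP sh)/facetsP[_ mB]].
  apply: sc; rewrite inE [_ \in link _ _]inE; apply/negP => /and4P[_ _ vBG vBD].
  by case/negP: vBG; rewrite -(mB _ vBD) ?setU11 ?subsetUr.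
(* The two fillings of [c], its cone and [b], form the suspension. As [b] avoids [v], the
   coefficient at [v |: A] is that of [c] at [A] up to sign. *)
exists (v |: A), (v |: F), (fun B => cone v c B - b B); split.
- split=> [||B BD]; rewrite ?setUS //; first by move: FD; rewrite inE => /and3P[].
  rewrite subUset sub1set => /andP[vB sAB].
  rewrite -(setD1K vB) setUS // uF //; last by rewrite subsetD1 sAB.
  by rewrite !inE eqxx setD1K //= BD andbT; apply: cD BD; apply: subsetDl.
- rewrite GE => B BD; rewrite (supported_cone _ _ BD); first last.
  + by rewrite link_face_link.
  + exact: subset_closed_face_link.
  by rewrite sb ?subr0 //; apply: contraNN BD; apply: sdD.
- move=> W; rewrite bdB bE bd_cone scale1r /cone zc scaler0 if_same subr0.
  exact: subrr.
rewrite /cone setU11 setU1K // sb ?subr0 ?scaler_eq0 ?signr_eq0 //.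
by rewrite !inE eqxx !andbF.
Qed.

End VertexDecomposable.

(** * Coefficients of monomial multiples and division by a variable *)

Section MonomialMultiples.
Variables (K : fieldType) (n : nat).
Implicit Types (p : {mpoly K[n]}) (m k : 'X_{1..n}) (i : 'I_n).

Lemma mcoeffMX_if p m k :
  (p * 'X_[m])@_k = if (m <= k)%MM then p@_(k - m) else 0.
Proof.
case: ifPn => [mk|mk]; first by rewrite -{1}(submK mk) addmC mcoeffMX.
apply: memN_msupp_eq0; rewrite (perm_mem (msuppMX _ _)); apply: contraNN mk.
by case/mapP=> m' _ ->; apply: lem_addr.
Qed.

Lemma mcoeff_signM (b : bool) p m : ((-1) ^+ b * p)@_m = (-1) ^+ b * p@_m.
Proof. by case: b; rewrite ?expr0 ?expr1 ?mul1r // !mulN1r mcoeffN. Qed.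

Lemma lem1E i m : (U_(i) <= m)%MM = (0 < m i)%N.
Proof.
apply/mnm_lepP/idP => [/(_ i)|mi j]; first by rewrite mnm1E eqxx.
by rewrite mnm1E; case: eqP => // <-.
Qed.

(* The quotient in the division of [p] by [X_i]. *)
Definition quoX i p : {mpoly K[n]} :=
  \sum_(m <- msupp p | (0 < m i)%N) p@_m *: 'X_[m - U_(i)].

Lemma mcoeff_quoX i p m : (quoX i p)@_m = p@_(m + U_(i)).
Proof.
rewrite raddf_sum /= big_mkcond /=.
rewrite (eq_bigr (fun m' => if m' == (m + U_(i))%MM then p@_m' else 0)); last first.
  move=> m' _; rewrite mcoeffZ mcoeffX; case: (eqVneq m' _) => [->|mm'].
    by rewrite mnmDE mnm1E eqxx addn1 /= addmK eqxx mulr1.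
  case: ifPn => // mi; case: eqP => [e|]; last by rewrite mulr0.
  by case/eqP: mm'; rewrite -e submK // lem1E.
case: (boolP ((m + U_(i))%MM \in msupp p)) => mp.
  rewrite (bigD1_seq _ mp) ?msupp_uniq //= eqxx big1 ?addr0 // => m'.
  by move/negbTE => ->.
rewrite (memN_msupp_eq0 mp) big_seq big1 // => m' m'p.
by case: eqP m'p => // ->; rewrite (negbTE mp).
Qed.

End MonomialMultiples.

(** * Exactness of the Koszul complex of the variables *)

Section KoszulExactness.
Variables (K : fieldType) (V : finType) (r : nat).
Notation S := {mpoly K[#|V|]}.
Implicit Types (z w : {set V} -> 'rV[S]_r) (W : {set V}) (s t v : V).

Definition var v : S := 'X_(enum_rank v).

Lemma mcoeff_bd z W j m : (bd var z W 0 j)@_m =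
  \sum_(t | t \notin W) (-1) ^+ parity t W *
    (if (0 < m (enum_rank t))%N then (z (t |: W) 0 j)@_(m - U_(enum_rank t)) else 0).
Proof.
rewrite summxE raddf_sum; apply: eq_bigr => t _.
rewrite !mxE -mulrA [_ * z _ _ _]mulrC -lem1E -mcoeffMX_if.
exact: mcoeff_signM.
Qed.

(* The homotopy [cone v \o quoX v] contracts everything but the part not
   involving [v]. *)
Lemma koszul_kill_var v z : bd var z =1 (fun=> 0) ->
  exists w, forall W j m, ((z W - bd var w W) 0 j)@_m =
    if (v \notin W) && (m (enum_rank v) == 0)%N then (z W 0 j)@_m else 0.
Proof.
move=> zc; pose q W := map_mx (quoX (enum_rank v)) (z W).
have qE W j m : (q W 0 j)@_m = (z W 0 j)@_(m + U_(enum_rank v)).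
  by rewrite mxE mcoeff_quoX.
have XqE W j m : ((var v *: q W) 0 j)@_m =
    if m (enum_rank v) == 0%N then 0 else (z W 0 j)@_m.
  rewrite [(var v *: q W) _ _]mxE mulrC mcoeffMX_if lem1E lt0n.
  by case: eqP => //= /eqP; rewrite -lt0n -lem1E qE => /submK ->.
exists (cone v q) => W j m; rewrite bd_cone opprB addrCA.
rewrite [LHS](_ : _ = (cone v (bd var q) W 0 j)@_m +
    ((z W 0 j)@_m - ((var v *: q W) 0 j)@_m));
  last by rewrite !mxE mcoeffD mcoeffB.
rewrite XqE /cone; case: ifPn => vW /=; last first.
  by rewrite mxE mcoeff0 add0r; case: ifP; rewrite ?subr0 ?subrr.
set B := W :\ v; have vB : v \notin B by rewrite setD11.
rewrite [((-1) ^+ parity v W *: bd var q B) _ _]mxE mcoeff_signM.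
(* In this coefficient of [bd var z B = 0] the term of [v] isolates the coefficient of [m] in [z W];
   the other terms make up [bd var q B]. *)
have := congr1 (fun u : 'rV_r => (u 0 j)@_(m + U_(enum_rank v))) (zc B).
rewrite !mcoeff_bd [in RHS]mxE mcoeff0 !(bigD1 v vB) /= setD1K //.
rewrite mnmDE mnm1E eqxx addn1 /= addmK => /eqP; rewrite addr_eq0 => /eqP e.
rewrite [\sum_(_ | _) _](_ : _ = - ((-1) ^+ parity v B * (z W 0 j)@_m)); last first.
  rewrite e opprK; apply: eq_bigr => t /andP[_ tv]; congr (_ * _).
  rewrite mnmDE mnm1E (inj_eq enum_rank_inj) eq_sym (negbTE tv) addn0.
  case: ifP => // mt; rewrite qE; congr (_@_ _).
  apply/mnmP => i; rewrite !(mnmDE, mnmBE) addnBAC //.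
  by have := lem1E (enum_rank t) m; rewrite mt => /mnm_lepP.
rewrite /B parityD1 -mulrBr mulrA -signr_addb addbb mul1r -[in RHS](subrr (z W 0 j)@_m).
rewrite qE; case: posnP => mv; first by rewrite sub0r subr0 addNr subrr.
by rewrite submK ?lem1E // !subrr addr0.
Qed.

(** Killing the variables one after the other leaves only the constant terms of [z set0], where all
    the homology sits. *)
Lemma koszul_exact z : bd var z =1 (fun=> 0) -> (forall j, (z set0 0 j)@_0%MM = 0) ->
  exists w, bd var w =1 z.
Proof.
move=> zc z0.
suff [w wE] : exists w, forall W j m, ((z W - bd var w W) 0 j)@_m =
    if all (fun v => (v \notin W) && (m (enum_rank v) == 0)%N) (enum V)
    then (z W 0 j)@_m else 0.
  exists w => W; apply/esym/eqP; rewrite -subr_eq0; apply/eqP/matrixP => i j.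
  rewrite ord1 [RHS]mxE; apply/mpolyP => m; rewrite wE mcoeff0.
  case: allP => // Wm; have -> : W = set0.
    by apply/setP => v; rewrite inE; apply/negbTE; case/andP: (Wm v (mem_enum _ _)).
  suff -> : m = 0%MM by [].
  apply/mnmP => k; rewrite mnm0E -(enum_valK k).
  by case/andP: (Wm (enum_val k) (mem_enum _ _)) => _ /eqP.
elim: (enum V) => [|v s [w wE]].
  by exists (fun=> 0) => W j m; rewrite bd0 subr0.
have [|w' w'E] := @koszul_kill_var v (fun W => z W - bd var w W).
  by move=> W; rewrite bdB zc bd_bd subrr.
exists (fun W => w W + w' W) => W j m; rewrite bdD opprD addrA w'E wE.
by rewrite /=; case: (_ && _).
Qed.

End KoszulExactness.

(** * Restriction of polynomials to a set of monomials *)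

Section Truncation.
Variables (K : fieldType) (n : nat).
Implicit Types (p d : {mpoly K[n]}) (m : 'X_{1..n}) (P Q : pred 'X_{1..n}).

(** A general predicate covers both homogeneous components and setting some variables to 0. *)
Definition mpart P p : {mpoly K[n]} := \sum_(m <- msupp p | P m) p@_m *: 'X_[m].

Lemma mcoeff_mpart P p m : (mpart P p)@_m = if P m then p@_m else 0.
Proof.
rewrite raddf_sum /=.
rewrite (eq_bigr (fun k => if k == m then p@_m else 0)); last first.
  move=> k _; rewrite mcoeffZ mcoeffX; case: eqP => [->|_]; last by rewrite mulr0.
  by rewrite mulr1.
case: (boolP (m \in msupp p)) => mp; last first.
  rewrite (memN_msupp_eq0 mp) if_same big_seq_cond big1 // => k _.
  by rewrite if_same.
rewrite big_mkcond (bigD1_seq _ mp) ?msupp_uniq //= eqxx big1 ?addr0 // => k.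
by move/negbTE => ->; rewrite if_same.
Qed.

Lemma mpart_mul P Q p d :
  (forall m k, d@_k != 0 -> P (m + k)%MM = Q m) ->
  mpart P (p * d) = mpart Q p * d.
Proof.
move=> PQ; apply/mpolyP => m; rewrite mcoeff_mpart !mcoeffM.
case: ifPn => Pm; [apply: eq_bigr|apply/esym; apply: big1] => k /eqP mE;
  rewrite mcoeff_mpart; case: (eqVneq d@_k.2 0) => [->|dk]; rewrite ?mulr0 //;
  rewrite -(PQ k.1 _ dk) -mE.
  by rewrite Pm.
by rewrite (negbTE Pm) mul0r.
Qed.

Lemma mpartD P p q : mpart P (p + q) = mpart P p + mpart P q.
Proof.
apply/mpolyP => m; rewrite mcoeffD !mcoeff_mpart mcoeffD.
by case: ifP; rewrite ?addr0.
Qed.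

Lemma mpartB P p q : mpart P (p - q) = mpart P p - mpart P q.
Proof.
apply/mpolyP => m; rewrite mcoeffB !mcoeff_mpart mcoeffB.
by case: ifP; rewrite ?subr0.
Qed.

Lemma mpart0 P : mpart P 0 = 0.
Proof. by rewrite /mpart msupp0 big_nil. Qed.

Lemma mpart_sum (T : finType) P (F : T -> {mpoly K[n]}) :
  mpart P (\sum_i F i) = \sum_i mpart P (F i).
Proof. exact: (big_morph _ (@mpartD P) (mpart0 P)). Qed.

Lemma mpart_id P p : {in msupp p, forall m, P m} -> mpart P p = p.
Proof.
move=> pP; apply/mpolyP => m; rewrite mcoeff_mpart.
case: (boolP (m \in msupp p)) => [/pP -> //|mp].
by rewrite memN_msupp_eq0 // if_same.
Qed.

End Truncation.

(** * Vanishing of Koszul classes of [S / I] from degree bounds on a resolution *)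

Section KoszulRegularity.
Variables (K : fieldType) (V : finType).
Notation S := {mpoly K[#|V|]}.
Variables (I : {pred S}) (X : graded_free_sequence K #|V|).
Hypotheses (gX : gf_graded X) (rX : gf_resolves I X).
Implicit Types (W : {set V}) (s t v : V).

Definition row_homog p e (u : 'rV[S]_(gf_rank X p)) :=
  forall k, {in msupp (u 0 k), forall m, (mdeg m + gf_deg k = e)%N}.

Definition row_part p e (u : 'rV[S]_(gf_rank X p)) : 'rV[S]_(gf_rank X p) :=
  \row_k mpart (fun m => mdeg m + gf_deg k == e)%N (u 0 k).

Lemma row_part_homog p e (u : 'rV_(gf_rank X p)) : row_homog e (row_part e u).
Proof.
move=> k m; rewrite mxE mcoeff_msupp mcoeff_mpart.
by case: ifP => [/eqP //|_]; rewrite eqxx.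
Qed.

Lemma row_part_diff p e (u : 'rV_(gf_rank X p)) (w : 'rV_(gf_rank X p.+1)) :
  row_homog e u -> u = w *m gf_diff X p -> u = row_part e w *m gf_diff X p.
Proof.
move=> uH uE; apply/rowP => l; rewrite mxE.
rewrite -[LHS](@mpart_id _ _ (fun m => mdeg m + gf_deg l == e)%N); last first.
  by move=> m /uH ->.
rewrite uE mxE mpart_sum; apply: eq_bigr => k _; rewrite mxE.
apply: mpart_mul => m m'; rewrite -mcoeff_msupp => m'd.
by rewrite mdegD -addnA (gX.1 _ _ _ m' m'd).
Qed.

Lemma row_part_aug e (u : 'rV_(gf_rank X 0)) :
  mpart (fun m => mdeg m == e) ((u *m gf_aug X) 0 0)
    = (row_part e u *m gf_aug X) 0 0.
Proof.
rewrite !mxE mpart_sum; apply: eq_bigr => k _; rewrite mxE.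
apply: mpart_mul => m m'; rewrite -mcoeff_msupp mdegD => m'a.
have /dhomogP aH := gX.2 k; by rewrite (aH _ m'a).
Qed.

Lemma diff_diff p (w : 'rV_(gf_rank X p.+2)) :
  w *m gf_diff X p.+1 *m gf_diff X p = 0.
Proof. by case: rX => _ _ ex; apply/ex; exists w. Qed.

Lemma bd_mulmx q r (M : 'M[S]_(q, r)) (z : {set V} -> 'rV[S]_q) W :
  bd (@var K V) (fun F => z F *m M) W = bd (@var K V) z W *m M.
Proof. by rewrite mulmx_suml; apply: eq_bigr => t _; rewrite scalemxAl. Qed.

Lemma row_homog_bd p e (z : {set V} -> 'rV_(gf_rank X p)) W :
  (forall F, row_homog e (z F)) -> row_homog e.+1 (bd (@var K V) z W).
Proof.
move=> zH k m; rewrite mcoeff_msupp mcoeff_bd => nz.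
have [t tW] : exists2 t, t \notin W &
    (if (0 < m (enum_rank t))%N then (z (t |: W) 0 k)@_(m - U_(enum_rank t)) else 0) != 0.
  apply: contrapT => no; case/eqP: nz; apply: big1 => t tW.
  apply/eqP; rewrite mulf_eq0 signr_eq0; apply/negPn/negP => nt.
  by case: no; exists t.
case: ifP => [mt|]; last by rewrite eqxx.
rewrite -mcoeff_msupp => /zH <-; rewrite -lem1E in mt.
by rewrite -{1}(submK mt) mdegD mdeg1 addn1 addSn.
Qed.

Variable c : nat.
Hypothesis degX : forall p (k : 'I_(gf_rank X p)), (gf_deg k < c + p)%N.

(* The cokernel of [gf_diff X p] has regularity less than [c + p], so its
   Koszul homology of homological degree [i] vanishes in internal degrees
   [e + i] with [e >= c + p]. Taking Koszul boundaries, and lifting them along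
   [gf_diff X p], reduces [(i + 1, p)] to [(i, p + 1)]. *)
Lemma koszul_cycle_bounds i p e (z : {set V} -> 'rV_(gf_rank X p)) :
  (c + p <= e)%N -> (forall W, #|W| != i -> z W = 0) ->
  (forall W, row_homog e (z W)) ->
  (forall W, exists w, bd (@var K V) z W = w *m gf_diff X p) ->
  exists u y, forall W, z W = bd (@var K V) u W + y W *m gf_diff X p.
Proof.
elim: i p e z => [|i IHi] p e z pe zi zH zc.
  (* Entries of [z set0] have degree [e - gf_deg j > 0], hence no constant term. *)
  have [W|j|u uE] := @koszul_exact K V _ z.
  - apply: big1 => t tW; rewrite zi ?scaler0 // cardsU1 tW //.
  - apply: memN_msupp_eq0; apply/negP => /zH; rewrite mdeg0 add0n => dj.
    by have := degX j; rewrite dj ltnNge pe.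
  by exists u, (fun=> 0) => W; rewrite uE mul0mx addr0.
(* A variable raises the degree by one, hence [e.+1]. The lifts are homogeneous and vanish off
   cardinality [i], as the induction hypothesis asks. *)
have /choice[w wP] : forall W, exists w : 'rV_(gf_rank X p.+1),
    [/\ bd (@var K V) z W = w *m gf_diff X p, row_homog e.+1 w & #|W| != i -> w = 0].
  move=> W; case: (eqVneq #|W| i) => Wi.
    have [w wE] := zc W; exists (row_part e.+1 w); split=> //.
      by apply: row_part_diff => //; apply: row_homog_bd.
    exact: row_part_homog.
  exists 0; split=> //; last by move=> k m; rewrite mxE msupp0.
  rewrite mul0mx; apply: big1 => t tW; rewrite zi ?scaler0 //.
  by rewrite cardsU1 tW add1n eqSS.
have [|W Wi|W|W|u [y wE]] := IHi p.+1 e.+1 w.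
- by rewrite addnS ltnS.
- by have [_ _ ->] := wP W.
- by have [_ ] := wP W.
- case: rX => _ _ ex; apply/ex; rewrite -bd_mulmx.
  rewrite (@bd_ext _ _ _ _ _ (bd (@var K V) z)) ?bd_bd // => F.
  by have [->] := wP F.
(* [bd] never reads the value at [set0]; making it 0 secures the constant-term condition of
   [koszul_exact]. *)
pose u' W := if W == set0 then 0 else u W.
have u'E : bd (@var K V) u' =1 bd (@var K V) u.
  move=> W; apply: eq_bigr => t tW; rewrite /u'; case: eqP => // /setP/(_ t).
  by rewrite !inE eqxx.
have [W|j|x xE] := @koszul_exact K V _ (fun W => z W - u' W *m gf_diff X p).
- rewrite bdB bd_mulmx u'E; have [-> _ _] := wP W.
  by rewrite wE mulmxDl diff_diff addr0 subrr.
- by rewrite zi ?cards0 // /u' eqxx mul0mx subr0 mxE mcoeff0.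
by exists x, u' => W; rewrite xE subrK.
Qed.

Hypotheses (I0 : 0 \in I) (ID : {in I &, forall f g, f + g \in I})
  (IM : forall h f, f \in I -> h * f \in I)
  (IH : forall e f, f \in I -> mpart (fun m => mdeg m == e) f \in I).

(** In [S / I] the chain [f e_U] is a Koszul cycle. A lift to [F_0] of the same degree is filled
    modulo the image of [F_1], and [gf_aug] carries the filling back. *)
Lemma koszul_class_bounds (U : {set V}) (f : S) : f \is c.-homog ->
  (forall t, t \in U -> var K t * f \in I) ->
  exists u : {set V} -> 'rV[S]_1, forall W,
    bd (@var K V) u W 0 0 - (if W == U then f else 0) \in I.
Proof.
have IN g : g \in I -> - g \in I by rewrite -mulN1r; apply: IM.
move=> fH fU; case: (rX) => lift ker0 _; have [w0 w0E] := lift f.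
pose w := row_part c w0.
have wE : f - (w *m gf_aug X) 0 0 \in I.
  have := IH c w0E; rewrite mpartB row_part_aug mpart_id // => m mf.
  by apply/eqP; move/dhomogP: fH; apply.
pose z W := if W == U then w else 0.
have [|W Wi|W|W|u [y zE]] := @koszul_cycle_bounds #|U| 0 c z.
- by rewrite addn0.
- by rewrite /z; case: ifP => // /eqP WU; rewrite WU eqxx in Wi.
- rewrite /z; case: ifP => _; first exact: row_part_homog.
  by move=> k m; rewrite mxE msupp0.
- apply/ker0; rewrite -bd_mulmx summxE; apply: (big_ind (fun g => g \in I)) => // t tW.
  rewrite mxE -mulrA; apply: IM; rewrite /z; case: eqP => [tWU|_]; last first.
    by rewrite mul0mx mxE mulr0.
  rewrite -[_ * _](subKr (var K t * f)); apply: ID.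
    by apply: fU; rewrite -tWU setU11.
  by apply: IN; rewrite -mulrBr; apply: IM.
exists (fun W => u W *m gf_aug X) => W; rewrite bd_mulmx.
have -> : bd (@var K V) u W = z W - y W *m gf_diff X 0 by rewrite zE addrK.
rewrite mulmxBl.
have yI : (y W *m gf_diff X 0 *m gf_aug X) 0 0 \in I by apply/ker0; exists (y W).
rewrite mxE [X in _ + X - _]mxE addrAC; apply: ID; last exact: IN.
rewrite /z; case: eqP => _; last by rewrite mul0mx mxE subrr.
by rewrite -opprB; apply: IN.
Qed.

End KoszulRegularity.

(** * Stanley-Reisner ideals: membership, colon ideals and a Koszul class *)

Section StanleyReisnerIdeal.
Variables (K : fieldType) (V : finType).
Notation S := {mpoly K[#|V|]}.
Implicit Types (D : {set {set V}}) (A B F G W : {set V}) (t v : V) (f g h : S).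
Implicit Types (m k : 'X_{1..#|V|}).

Definition mnm_supp m : {set V} := [set v | (0 < m (enum_rank v))%N].

Definition face_mnm F : 'X_{1..#|V|} := (\sum_(v in F) U_(enum_rank v))%MM.

Lemma face_mnmE F v : face_mnm F (enum_rank v) = (v \in F).
Proof.
rewrite mnm_sumE (eq_bigr (fun t => nat_of_bool (t == v))); last first.
  by move=> t _; rewrite mnm1E (inj_eq enum_rank_inj).
case: (boolP (v \in F)) => vF.
  by rewrite (bigD1 v) //= eqxx big1 // => t /andP[_ /negbTE ->].
by rewrite big1 // => t tF; case: eqP vF => // <-; rewrite tF.
Qed.

Lemma mnm_enumP m k : (forall v, m (enum_rank v) = k (enum_rank v)) -> m = k.
Proof. by move=> mk; apply/mnmP => i; rewrite -(enum_valK i). Qed.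

Lemma face_monomialE F : face_monomial K F = 'X_[face_mnm F].
Proof. by rewrite /face_mnm (big_morph _ (@mpolyXD #|V| K) (@mpolyX0 #|V| K)). Qed.

Lemma mdeg_face_mnm F : mdeg (face_mnm F) = #|F|.
Proof. by rewrite mdeg_sum (eq_bigr (fun=> 1%N)) ?sum1_card // => v _; apply: mdeg1. Qed.

Lemma face_monomial_homog F : face_monomial K F \is #|F|.-homog.
Proof. by rewrite face_monomialE dhomogX; apply/eqP/mdeg_face_mnm. Qed.

Lemma mnm_supp_face F : mnm_supp (face_mnm F) = F.
Proof. by apply/setP => v; rewrite inE face_mnmE lt0b. Qed.

Lemma mnm_suppD m k : mnm_supp (m + k)%MM = mnm_supp m :|: mnm_supp k.
Proof. by apply/setP => v; rewrite !inE mnmDE addn_gt0. Qed.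

Lemma lem_face_mnm F m : (face_mnm F <= m)%MM = (F \subset mnm_supp m).
Proof.
apply/mnm_lepP/subsetP => [Fm v vF|Fm i].
  by have := Fm (enum_rank v); rewrite face_mnmE vF inE.
rewrite -(enum_valK i) face_mnmE; case: (boolP (_ \in F)) => // /Fm.
by rewrite inE.
Qed.

Lemma face_mnmD1 F v : v \in F -> (face_mnm F - U_(enum_rank v))%MM = face_mnm (F :\ v).
Proof.
move=> vF; apply: mnm_enumP => t; rewrite mnmBE !face_mnmE mnm1E !inE.
rewrite (inj_eq enum_rank_inj) [v == t]eq_sym.
by case: eqP => [->|_]; rewrite ?vF ?subn0.
Qed.

(** A monomial is a multiple of some generator exactly when its support is not a face. *)
Lemma stanley_reisnerP D f : subset_closed D ->
  reflect (forall m, mnm_supp m \in D -> f@_m = 0) (f \in stanley_reisner K D).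
Proof.
move=> cD; apply: (iffP (asboolP _)) => [[q ->] m mD|f0].
  rewrite raddf_sum; apply: big1 => F FD /=.
  rewrite face_monomialE mcoeffMX_if lem_face_mnm; case: ifP => // Fm.
  by rewrite (cD _ _ Fm mD) in FD.
exists (fun F => \sum_(m <- msupp f | mnm_supp m == F) f@_m *: 'X_[m - face_mnm F]).
rewrite {1}[f]mpolyE (eq_bigr (fun F =>
  \sum_(m <- msupp f | mnm_supp m == F) f@_m *: 'X_[m])); last first.
  move=> F _; rewrite mulr_suml; apply: eq_bigr => m /eqP mF.
  by rewrite face_monomialE -scalerAl -mpolyXD submK // lem_face_mnm mF.
rewrite (exchange_big_dep xpredT) //=; apply: eq_bigr => m _.
case: (boolP (mnm_supp m \in D)) => mD; last first.
  rewrite (bigD1 (mnm_supp m)) ?mD ?eqxx //= big1 ?addr0 // => F /andP[/andP[_ /eqP ->]].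
  by rewrite eqxx.
rewrite f0 // scale0r big1 // => F _; exact: scale0r.
Qed.

Section Ideal.
Variable D : {set {set V}}.
Hypothesis cD : subset_closed D.

Lemma stanley_reisner0 : 0 \in stanley_reisner K D.
Proof. by apply/stanley_reisnerP => // m _; rewrite mcoeff0. Qed.

Lemma stanley_reisnerD : {in stanley_reisner K D &, forall f g,
  f + g \in stanley_reisner K D}.
Proof.
move=> f g /(stanley_reisnerP _ cD) f0 /(stanley_reisnerP _ cD) g0.
by apply/stanley_reisnerP => // m mD; rewrite mcoeffD f0 ?g0 ?addr0.
Qed.

Lemma stanley_reisnerM h f : f \in stanley_reisner K D -> h * f \in stanley_reisner K D.
Proof.
move=> /(stanley_reisnerP _ cD) f0; apply/stanley_reisnerP => // m mD.
rewrite mcoeffM; apply: big1 => k /eqP mE; rewrite f0 ?mulr0 //.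
by apply: cD mD; have := mnm_suppD k.1 k.2; rewrite -mE => ->; apply: subsetUr.
Qed.

Lemma stanley_reisner_mpart P f :
  f \in stanley_reisner K D -> mpart P f \in stanley_reisner K D.
Proof.
move=> /(stanley_reisnerP _ cD) f0; apply/stanley_reisnerP => // m mD.
by rewrite mcoeff_mpart f0 // if_same.
Qed.

Lemma var_face_monomial t A : t |: A \notin D ->
  var K t * face_monomial K A \in stanley_reisner K D.
Proof.
move=> tA; apply/stanley_reisnerP => // m mD.
rewrite face_monomialE -mpolyXD mcoeffX; case: eqP => // mE.
case/negP: tA; apply: cD mD; rewrite -mE mnm_suppD mnm_supp_face setSU //.
by apply/subsetP => v /set1P ->; rewrite inE mnm1E eqxx.
Qed.

(* [I : x^A] is generated by the variables outside [F]. *)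
Lemma v_witness_unique_facet A F :
  unique_facet D A F -> v_witness (stanley_reisner K D) #|A|.
Proof.
case=> sAF FD uF; pose inF m := mnm_supp m \subset F.
have inFD m k : inF (m + k)%MM = inF m && inF k by rewrite /inF mnm_suppD subUset.
(* [mpart inF] is the ring map setting the variables outside [F] to 0; its kernel [P] is prime
   because the polynomial ring is a domain. *)
have mpartM g h : mpart inF (g * h) = mpart inF g * mpart inF h.
  apply/mpolyP => m; rewrite mcoeff_mpart !mcoeffM.
  case: ifPn => mF; [apply: eq_bigr|apply/esym; apply: big1] => k /eqP mE;
    have := inFD k.1 k.2; rewrite -mE !mcoeff_mpart.
    by rewrite mF => /esym/andP[-> ->].
  rewrite (negbTE mF).
  by case: (inF k.1); case: (inF k.2); rewrite ?mulr0 ?mul0r.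
pose P : {pred S} := fun g => mpart inF g == 0.
have PE g : (g \in P) = (mpart inF g == 0) by [].
have colP : colon (stanley_reisner K D) (face_monomial K A) =i P.
  (* Multiplying by [x^A] keeps monomials supported in [F] on this face; conversely, every face
     containing [A] lies in [F]. *)
  move=> g; rewrite PE unfold_in; apply/stanley_reisnerP/eqP => // [g0|g0 m mD].
    apply/mpolyP => m; rewrite mcoeff_mpart mcoeff0; case: ifP => // mF.
    rewrite -(g0 (face_mnm A + m)%MM) ?face_monomialE ?mcoeffMX //.
    by apply: cD FD; rewrite mnm_suppD mnm_supp_face subUset sAF.
  rewrite face_monomialE mcoeffMX_if lem_face_mnm; case: ifP => // Am.
  have := mcoeff_mpart inF g (m - face_mnm A); rewrite g0 mcoeff0.
  case: ifP => // /negP[]; apply: subset_trans (uF _ mD Am).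
  by rewrite -{2}(@submK _ (face_mnm A) m) ?lem_face_mnm // mnm_suppD subsetUl.
exists (face_monomial K A), P; split=> //; first exact: face_monomial_homog.
split; last by exists (face_monomial K A).
split; last by move=> g h; rewrite !PE mpartM mulf_eq0.
split=> [||q g h]; rewrite !PE.
- by rewrite mpart0.
- apply/eqP => /mpolyP/(_ 0%MM)/eqP; rewrite mcoeff_mpart mcoeff0 mcoeff1 eqxx.
  have -> : inF 0%MM by apply/subsetP => v; rewrite inE mnm0E.
  by rewrite oner_eq0.
by move=> /eqP g0 /eqP h0; rewrite mpartD mpartM g0 h0 mulr0 addr0.
Qed.

Lemma parityID t W B : parity t W = parity t (W :&: B) (+) parity t (W :\: B).
Proof.
rewrite /parity -oddD -(cardsID B [set u in W | rank_lt u t]).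
by congr (odd (_ + _)); apply: eq_card => u; rewrite !inE ?andbA // andbAC.
Qed.

(* Koszul cycles of multidegree [W] in [S / I] are the simplicial cocycles of
   [D] restricted to [W], with [x^B e_(W :\: B)] corresponding to [B]. Here
   [W = ~: (F :\: A)]: the cochain of [A] is a cocycle because [A] is a facet of
   the restriction, and it is not a coboundary because it pairs nontrivially
   with the cycle [c]. *)
Lemma koszul_class_nonzero A F (c : {set V} -> K^o) (u : {set V} -> 'rV[S]_1) :
  unique_facet D A F -> supported c (face_link D (F :\: A)) ->
  bd (fun=> 1) c =1 (fun=> 0) -> c A != 0 ->
  (forall W, bd (@var K V) u W 0 0 - (if W == ~: F then face_monomial K A else 0)
     \in stanley_reisner K D) -> False.
Proof.
case=> sAF FD uF sc zc cA uI.
set W0 := ~: (F :\: A).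
have cP B : c B != 0 -> B \in D /\ B \subset W0.
  move=> cB; have : B \in face_link D (F :\: A) by apply: contraNT cB => /sc ->.
  rewrite inE disjoints_subset => /andP[BW BD]; split=> //.
  by apply: cD BD; apply: subsetUl.
(* This sign turns Koszul signs on [W0 :\: B] into simplicial signs on [B]; [parityID] supplies the
   comparison. *)
pose eps B : K := \prod_(t in B) (-1) ^+ parity t W0.
pose g B := (u (W0 :\: B) 0 0)@_(face_mnm B).
(* Up to [eps], the part of [bd var u] in multidegree [W0] is the coboundary of [g], so pairing it
   with [c] is pairing [g] with the boundary of [c], which is 0. *)
have pairing : \sum_B c B * eps B * (bd (@var K V) u (W0 :\: B) 0 0)@_(face_mnm B) = 0.
  transitivity (\sum_(B : {set V}) \sum_(t | t \notin B)
    g B * eps B * ((-1) ^+ parity t B * c (t |: B))).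
    transitivity (\sum_(B : {set V}) \sum_(t in B)
      c B * eps B * ((-1) ^+ parity t (W0 :\: B) * g (B :\ t))).
      apply: eq_bigr => B _; case: (eqVneq (c B) 0) => [->|/cP[_ BW]].
        by rewrite !mul0r big1 // => t _; rewrite !mul0r.
      rewrite mcoeff_bd mulr_sumr (bigID (mem B)) /= [X in _ + X]big1 ?addr0; last first.
        by move=> t /andP[_ tB]; rewrite face_mnmE (negbTE tB) !mulr0.
      apply: eq_big => [t|t /andP[_ tB]].
        by rewrite in_setD; case: (t \in B); rewrite ?andbF.
      rewrite face_mnmE tB face_mnmD1 //; congr (_ * (_ * (u _ 0 0)@_ _)).
      apply/setP => s; rewrite !inE; case: (eqVneq s t) => [->|] //=.
      by have := subsetP BW _ tB; rewrite !inE => ->.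
    rewrite !pair_big_dep /=.
    rewrite (reindex_onto (fun q : {set V} * V => (q.2 |: q.1, q.2))
                          (fun q => (q.1 :\ q.2, q.2))) /=; last first.
      by move=> [B t] /= tB; rewrite setD1K.
    apply: eq_big => [[B t]|[B t]] /=.
      rewrite setU11 xpair_eqE eqxx andbT; apply/eqP/idP => [<-|]; last exact: setU1K.
      by rewrite setD11.
    rewrite setU11 xpair_eqE eqxx andbT => /eqP tB.
    have {}tB : t \notin B by rewrite -tB setD11.
    rewrite setU1K //; case: (eqVneq (c (t |: B)) 0) => [->|/cP[_ tBW]].
      by rewrite !(mul0r, mulr0).
    rewrite /eps (big_setU1 _ tB) /= -/(eps B) (parityID t W0 (t |: B)) (setIidPr tBW).
    rewrite parityU // rank_ltxx /=.
    case: (parity t B); case: (parity t _); rewrite /= ?expr0 ?expr1; ring.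
  apply: big1 => B _; rewrite -mulr_sumr [\sum_(_ | _) _](_ : _ = bd (fun=> 1) c B).
    by rewrite zc mulr0.
  by apply: eq_bigr => t _; rewrite mulr1.
case/eqP: cA; have epsA : eps A != 0 by apply/prodf_neq0 => t _; rewrite signr_eq0.
apply/eqP; rewrite -(mulIr_eq0 _ (mulIf epsA)); apply/eqP.
(* Only [B = A] survives, with coefficient 1, since [W0 :\: A] is [~: F]. Any other [B] with
   [c B != 0] is a face with [W0 :\: B] distinct from [~: F], so its coefficient is 0. *)
rewrite -pairing (bigD1 A) //= big1 => [|B BA].
  have <- : ~: F = W0 :\: A.
    apply/setP => t; rewrite !inE; case: (boolP (t \in A)) => //= /(subsetP sAF) ->.
    by [].
  have := uI (~: F); rewrite eqxx => /(stanley_reisnerP _ cD)/(_ (face_mnm A)).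
  rewrite mnm_supp_face face_monomialE mcoeffB mcoeffX eqxx => uA.
  have /eqP := uA (cD sAF FD); rewrite subr_eq0 => /eqP ->.
  by rewrite mulr1 addr0.
case: (eqVneq (c B) 0) => [->|/cP[BD BW]]; first by rewrite !mul0r.
have := uI (W0 :\: B); rewrite ifN => [/(stanley_reisnerP _ cD)/(_ (face_mnm B))|].
  by rewrite mnm_supp_face subr0 => -> //; rewrite mulr0.
apply: contraNneq BA => /(congr1 (fun X => W0 :\: X)).
rewrite setDDr setDv set0U (setIidPr BW) => ->; apply/eqP/setP => t.
rewrite !inE; case: (boolP (t \in A)) => [/(subsetP sAF) ->//|_] /=.
by case: (t \in F).
Qed.

End Ideal.
End StanleyReisnerIdeal.

(** * The v-number and the regularity compared through the degree of [x^A] *)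

Theorem theorem3p13 (K : fieldType) (V : finType) (D : {set {set V}})
    (V_nonempty : (0 < #|V|)%N) (D_complex : simplicial_complex D)
    (D_vd : vertex_decomposable D) :
  exists2 d : nat, is_v_number (stanley_reisner K D) d &
    forall r : int, is_regularity (stanley_reisner K D) r -> (d%:Z <= r)%R.
Proof.
have [cD Dv] := D_complex.
(* A vertex rules out the void complex, which [vertex_decomposable] allows. *)
have D0 : set0 \in D.
  by have [v _] := card_gt0P V_nonempty; apply: cD (Dv v); apply: sub0set.
have [A [F [c [uAF sc zc cA]]]] := unique_facet_cycle K cD D_vd D0.
have wA := v_witness_unique_facet K cD uAF.
have exw : exists d, `[< v_witness (stanley_reisner K D) d >].
  by exists #|A|; apply/asboolP.
case: (ex_minnP exw) => d /asboolP wd dmin; exists d.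
  by split=> // e we; apply/dmin/asboolP.
move=> r [X [[gX rX _] _ rmax]].
have dA : (d <= #|A|)%N by apply/dmin/asboolP.
(* If [r < d], all generators in homological degree [p] have degree below [#|A| + p], which forces
   the Koszul class of [x^A] to vanish. *)
case: (lerP d%:Z r) => // rd.
have degX p (k : 'I_(gf_rank X p)) : (gf_deg k < #|A| + p)%N.
  have : (gf_deg k)%:Z - p%:Z <= r.
    by apply: rmax; rewrite -lt0n; apply/card_gt0P; exists k; rewrite inE.
  lia.
have xA t : t \in ~: F -> var K t * face_monomial K A \in stanley_reisner K D.
  move=> tF; apply: var_face_monomial => //; case: uAF => _ _ uF.
  apply: contraL tF => /uF/(_ (subsetUr _ _))/subsetP/(_ t (setU11 _ _)).
  by rewrite inE negbK.
have [u uI] := @koszul_class_bounds K V _ X gX rX #|A| degX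
  (stanley_reisner0 K cD) (@stanley_reisnerD K V D cD) (@stanley_reisnerM K V D cD)
  (fun e f => @stanley_reisner_mpart K V D cD _ f) (~: F) (face_monomial K A)
  (face_monomial_homog K A)
  xA.
by case: (koszul_class_nonzero cD uAF sc zc cA uI).
Qed.
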